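(* Let $M$ be a $\lambda_\oplus$-term and $s\in\mathcal T(M)$. Then $T(M)_s=\dfrac1{m(s)}$.
   Context: $\lambda_\oplus$-terms are given by $M,N,P,Q ::= x\mid\lambda x.M\mid MN\mid M\oplus N$ up to renaming of bound variables. Resource terms and resource monomials are defined by mutual induction: $s,t ::= x\mid\lambda x.s\mid\langle s\rangle\bar t\mid s\oplus\bullet\mid\bullet\oplus s$ and $\bar t ::= [t_1,\dots,t_n]$, where monomials are finite multisets of resource terms ($\bar t\cdot\bar u$ is multiset union). For a set $X$, $\mathbb V(X)$ is the set of functions $X\to\mathbb Q_{\ge0}$, written as possibly infinite linear combinations $A=\sum_{a\in X}A_a\,a$, with $\mathrm{supp}(A)=\{a\mid A_a\ne0\}$. Constructors are extended componentwise: $\lambda x.S=\sum_sS_s\,\lambda x.s$, $S\oplus\bullet=\sum_sS_s(s\oplus\bullet)$, $\bullet\oplus S=\sum_sS_s(\bullet\oplus s)$, $\langle S\rangle\bar T=\sum_{s,\bar t}S_s\bar T_{\bar t}\,\langle s\rangle\bar t$, $[S_1,\dots,S_n]=\sum_{(s_1,\dots,s_n)}(\prod_i(S_i)_{s_i})[s_1,\dots,s_n]$. Let $S^n=[S,\dots,S]$ ($n$ copies; $S^0=[]$) and $S^!=\sum_{n\ge0}\frac1{n!}S^n$. The Taylor expansion is $T(x)=x$, $T(\lambda x.N)=\lambda x.T(N)$, $T(PQ)=\langle T(P)\rangle(T(Q))^!$, $T(P\oplus Q)=(T(P)\oplus\bullet)+(\bullet\oplus T(Q))$, and $\mathcal T(M)=\mathrm{supp}(T(M))$.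 The multiplicity $m$ is defined by $m(x)=1$; $m(\lambda x.s)=m(s\oplus\bullet)=m(\bullet\oplus s)=m(s)$; $m(\langle s\rangle\bar t)=m(s)m(\bar t)$; $m([t_1]^{n_1}\cdot\ldots\cdot[t_k]^{n_k})=\prod_{i=1}^kn_i!\,m(t_i)^{n_i}$ for pairwise distinct $t_i$, where $[t]^n$ is the multiset with $n$ copies of $t$. *)

(* Defs.v *)
From HB Require Import structures.
From mathcomp Require Import all_boot all_order all_algebra finmap multiset.
From mathcomp Require Import boolp classical_sets functions cardinality fsbigop.
Set Implicit Arguments.
Unset Strict Implicit.
Unset Printing Implicit Defensive.
Import Order.TTheory GRing.Theory Num.Theory.

Local Open Scope mset_scope.
Local Open Scope nat_scope.

(** ** Terms

    De Bruijn indices implement renaming of bound variables, both for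
    lambda-terms and for resource terms. *)

Inductive lterm : Type :=
| LVar of nat
| LLam of lterm
| LApp of lterm & lterm
| LSum of lterm & lterm.

(** Resource terms cannot be declared as an inductive type nested through
    [{mset _}]. They are obtained as the raw terms, with lists in place of
    multisets, all of whose lists are sorted for a fixed total order, so that
    each multiset has exactly one representative. The lemmas [RVar_inj] to
    [rterm_ind] show that [rterm] is freely generated by its constructors, with
    [RApp : rterm -> {mset rterm} -> rterm]. *)

Inductive rawterm : Type :=
| RawVar of nat
| RawLam of rawterm
| RawApp of rawterm & seq rawterm
| RawSuml of rawterm
| RawSumr of rawterm.

Fixpoint rawterm_nested_ind (P : rawterm -> Prop)
    (Pvar : forall x, P (RawVar x))
    (Plam : forall s, P s -> P (RawLam s))
    (Papp : forall s ts, P s -> foldr (fun t Q => P t /\ Q) True ts ->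
      P (RawApp s ts))
    (Psuml : forall s, P s -> P (RawSuml s))
    (Psumr : forall s, P s -> P (RawSumr s)) (r : rawterm) : P r :=
  let rec := rawterm_nested_ind Pvar Plam Papp Psuml Psumr in
  match r with
  | RawVar x => Pvar x
  | RawLam s => Plam s (rec s)
  | RawApp s ts => Papp s ts (rec s)
      ((fix all_rec us : foldr (fun t Q => P t /\ Q) True us :=
        match us with
        | [::] => I
        | u :: us' => conj (rec u) (all_rec us')
        end) ts)
  | RawSuml s => Psuml s (rec s)
  | RawSumr s => Psumr s (rec s)
  end.

Fixpoint rawterm_encode (r : rawterm) : GenTree.tree nat :=
  match r with
  | RawVar x => GenTree.Leaf x
  | RawLam s => GenTree.Node 0 [:: rawterm_encode s]
  | RawApp s ts =>
      GenTree.Node 1 (rawterm_encode s :: [seq rawterm_encode t | t <- ts])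
  | RawSuml s => GenTree.Node 2 [:: rawterm_encode s]
  | RawSumr s => GenTree.Node 3 [:: rawterm_encode s]
  end.

Fixpoint rawterm_decode (g : GenTree.tree nat) : rawterm :=
  match g with
  | GenTree.Leaf x => RawVar x
  | GenTree.Node 0 (s :: _) => RawLam (rawterm_decode s)
  | GenTree.Node 1 (s :: ts) =>
      RawApp (rawterm_decode s) [seq rawterm_decode t | t <- ts]
  | GenTree.Node 2 (s :: _) => RawSuml (rawterm_decode s)
  | GenTree.Node 3 (s :: _) => RawSumr (rawterm_decode s)
  | _ => RawVar 0
  end.

Lemma rawterm_encodeK : cancel rawterm_encode rawterm_decode.
Proof.
elim/rawterm_nested_ind => //= [s -> //|s ts -> Hts|s -> //|s -> //].
by congr RawApp; elim: ts Hts => //= t ts IH [-> /IH->].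
Qed.

HB.instance Definition _ := Countable.copy rawterm (can_type rawterm_encodeK).

Definition rawle : rel rawterm := relpre (@choice.pickle rawterm) leq.

Lemma rawle_total : total rawle.
Proof. by move=> r1 r2; apply: leq_total. Qed.

Lemma rawle_trans : transitive rawle.
Proof. by move=> r1 r2 r3; apply: leq_trans. Qed.

Lemma rawle_anti : antisymmetric rawle.
Proof. by move=> r1 r2 /anti_leq; apply: (pcan_inj (@choice.pickleK rawterm)). Qed.

Fixpoint canonical (r : rawterm) : bool :=
  match r with
  | RawVar _ => true
  | RawApp s ts => [&& canonical s, all canonical ts & sorted rawle ts]
  | RawLam s | RawSuml s | RawSumr s => canonical s
  end.

Record rterm : Type := RTerm { rval : rawterm; rvalP : canonical rval }.
HB.instance Definition _ := [isSub for rval].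
HB.instance Definition _ := [Countable of rterm by <:].

Definition rmonom : choiceType := {mset rterm}.

Lemma canonical_app (s : rterm) (ts : rmonom) :
  canonical (RawApp (rval s) (sort rawle [seq rval t | t <- enum_mset ts])).
Proof.
rewrite /= rvalP sort_sorted ?andbT; last exact: rawle_total.
by rewrite all_sort; apply/allP => _ /mapP[t _ ->]; apply: rvalP.
Qed.

Definition RVar (x : nat) : rterm := RTerm (isT : canonical (RawVar x)).
Definition RLam (s : rterm) : rterm :=
  RTerm (rvalP s : canonical (RawLam (rval s))).
Definition RApp (s : rterm) (ts : rmonom) : rterm := RTerm (canonical_app s ts).
Definition RSuml (s : rterm) : rterm :=
  RTerm (rvalP s : canonical (RawSuml (rval s))).
Definition RSumr (s : rterm) : rterm :=
  RTerm (rvalP s : canonical (RawSumr (rval s))).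

Lemma RVar_inj : injective RVar.
Proof. by move=> x y []. Qed.

Lemma RLam_inj : injective RLam.
Proof. by move=> s t [/val_inj]. Qed.

Lemma RSuml_inj : injective RSuml.
Proof. by move=> s t [/val_inj]. Qed.

Lemma RSumr_inj : injective RSumr.
Proof. by move=> s t [/val_inj]. Qed.

Lemma RApp_inj s s' ts ts' : RApp s ts = RApp s' ts' -> s = s' /\ ts = ts'.
Proof.
case=> /val_inj -> eq_ts; split=> //.
have /(perm_map_inj val_inj) : perm_eq (map val (enum_mset ts))
    (map val (enum_mset ts')).
  by rewrite -(perm_sort rawle) eq_ts perm_sort.
by move/eq_seq_msetP; rewrite !seq_mset_id.
Qed.

Lemma rterm_disjoint (x : nat) (s1 s2 s3 s4 : rterm) (ts : rmonom) :
  uniq [:: RVar x; RLam s1; RApp s2 ts; RSuml s3; RSumr s4].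
Proof. by []. Qed.

Lemma rterm_ind (P : rterm -> Prop) :
    (forall x, P (RVar x)) ->
    (forall s, P s -> P (RLam s)) ->
    (forall s (ts : {mset rterm}), P s -> (forall t, t \in ts -> P t) ->
      P (RApp s ts)) ->
    (forall s, P s -> P (RSuml s)) ->
    (forall s, P s -> P (RSumr s)) ->
  forall s, P s.
Proof.
move=> Pvar Plam Papp Psuml Psumr [r]; elim/rawterm_nested_ind: r.
- by move=> x cr; rewrite (_ : RTerm cr = RVar x)//; apply: val_inj.
- move=> s IH cr; rewrite (_ : RTerm cr = RLam (RTerm (cr : canonical s))).
    exact/Plam/IH.
  exact: val_inj.
- move=> s ts IHs IHts cr; have /and3P[cs cts sts] := cr.
  pose us : seq rterm := pmap insub ts.
  have usE : map val us = ts.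
    by rewrite pmap_filter ?(all_filterP _)//; [apply/allP=> t /(allP cts) ct;
      rewrite insubT | exact: insubK].
  rewrite (_ : RTerm cr = RApp (RTerm cs) (seq_mset us)).
    apply: Papp; first exact: IHs.
    move=> [t ct]; rewrite (perm_mem (perm_eq_seq_mset us)).
    move=> /(map_f val); rewrite usE /= => tts.
    elim: ts IHts tts {cts sts us usE cr} => //= u us IH [Pu Pus].
    by rewrite inE => /orP[/eqP eq_tu|]; [subst u; apply: Pu | exact: IH].
  apply: val_inj; congr RawApp.
  apply: (sorted_eq rawle_trans rawle_anti) => //.
    exact: sort_sorted rawle_total _.
  rewrite perm_sym perm_sort -usE.
  exact/perm_map/perm_eq_seq_mset.
- move=> s IH cr; rewrite (_ : RTerm cr = RSuml (RTerm (cr : canonical s))).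
    exact/Psuml/IH.
  exact: val_inj.
- move=> s IH cr; rewrite (_ : RTerm cr = RSumr (RTerm (cr : canonical s))).
    exact/Psumr/IH.
  exact: val_inj.
Qed.

(** ** Multiplicity

    On sorted raw terms equality of terms is plain equality, hence a raw monomial
    is tallied through the list of pairs [(t, m(t))]; the pairing only makes the
    recursion structural. [rmultE] gives the defining equations on resource
    terms. *)

Fixpoint rawmult (r : rawterm) : nat :=
  match r with
  | RawVar _ => 1
  | RawLam s | RawSuml s | RawSumr s => rawmult s
  | RawApp s ts =>
      let ps := [seq (t, rawmult t) | t <- ts] in
      rawmult s *
      \prod_(p <- undup ps) ((count_mem p ps)`! * p.2 ^ count_mem p ps)
  end.

Definition rmult (s : rterm) : nat := rawmult (rval s).

Definition rmonom_mult (ts : {mset rterm}) : nat :=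
  \prod_(t <- finsupp ts) ((ts t)`! * rmult t ^ ts t).

Lemma rmultE :
  [/\ forall x, rmult (RVar x) = 1,
      forall s, rmult (RLam s) = rmult s,
      forall s ts, rmult (RApp s ts) = rmult s * rmonom_mult ts,
      forall s, rmult (RSuml s) = rmult s &
      forall s, rmult (RSumr s) = rmult s].
Proof.
split=> // s ts; rewrite /rmult /=; congr (_ * _).
pose f r := (r, rawmult r).
have f_inj : injective f by move=> r1 r2 [].
have g_inj : injective (f \o val : rterm -> _) by apply: inj_comp val_inj.
set ps := map _ _.
have pps : perm_eq ps (map (f \o val) (enum_mset ts)).
  by rewrite map_comp; apply: perm_map; rewrite perm_sort.
have pu : perm_eq (undup ps) (map (f \o val) (finsupp ts)).
  rewrite (perm_trans (perm_undup (perm_mem pps)))// undup_map_inj//.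
  exact/perm_map/perm_undup_mset.
rewrite (perm_big _ pu) big_map /rmonom_mult; apply: eq_bigr => t _ /=.
suff -> : count_mem (f (val t)) ps = ts t by [].
rewrite (permP pps) count_map -count_mem_mset; apply: eq_count => u /=.
exact: (inj_eq g_inj).
Qed.

(** ** Vectors of nonnegative rationals *)

Local Open Scope classical_set_scope.
Local Open Scope ring_scope.

Record nnrat : Type := NNRat { nnval :> rat; nnvalP : nnval \in Num.nneg }.
HB.instance Definition _ := [isSub for nnval].
HB.instance Definition _ := [Choice of nnrat by <:].
HB.instance Definition _ := [SubChoice_isSubComNzSemiRing of nnrat by <:].

Lemma nnrat_inv_subproof (a : nnrat) : (nnval a)^-1 \in Num.nneg.
Proof. by rewrite nnegrE invr_ge0 -nnegrE nnvalP. Qed.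
Definition nnrat_inv (a : nnrat) : nnrat := NNRat (nnrat_inv_subproof a).

Definition vec (X : Type) : Type := X -> nnrat.

Definition supp (X : Type) (A : vec X) : set X := [set a | A a != 0].

(** ** Linear extension of the constructors

    The coefficient of [b] in the sum of the [S_a f(a)] is the sum of the [S_a]
    over the fibre of [f] at [b]. The operator [\sum_(_ \in _)] is the sum of a
    finitely supported family; that every family below is so is shown by
    [finite_fibre1], [finite_fibre_app], [finite_fibre_monom] and
    [finite_vprom]. *)

Definition vlin (X Y : choiceType) (f : X -> Y) (S : vec X) : vec Y :=
  fun b => \sum_(a \in [set a | f a = b]) S a.

Definition vvar (x : nat) : vec rterm := fun s => if s == RVar x then 1 else 0.

Definition vlam : vec rterm -> vec rterm := vlin RLam.
Definition vsuml : vec rterm -> vec rterm := vlin RSuml.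
Definition vsumr : vec rterm -> vec rterm := vlin RSumr.

Definition vapp (S : vec rterm) (T : vec rmonom) : vec rterm :=
  fun u => \sum_(p \in [set p : rterm * rmonom | RApp p.1 p.2 = u])
             (S p.1 * T p.2).

Definition vmonom (n : nat) (S : n.-tuple (vec rterm)) : vec rmonom :=
  fun ts => \sum_(t \in [set t : n.-tuple rterm | seq_mset t = ts])
              \prod_(i < n) tnth S i (tnth t i).

Definition vpow (S : vec rterm) (n : nat) : vec rmonom :=
  vmonom [tuple of nseq n S].

Definition vprom (S : vec rterm) : vec rmonom :=
  fun ts => \sum_(n \in [set: nat]) (nnrat_inv (n`!)%:R * vpow S n ts).

Definition vadd (X : Type) (A B : vec X) : vec X := fun a => A a + B a.

Fixpoint taylor (M : lterm) : vec rterm :=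
  match M with
  | LVar x => vvar x
  | LLam N => vlam (taylor N)
  | LApp P Q => vapp (taylor P) (vprom (taylor Q))
  | LSum P Q => vadd (vsuml (taylor P)) (vsumr (taylor Q))
  end.

Definition taylor_supp (M : lterm) : set rterm := supp (taylor M).

Lemma finite_fibre1 (X Y : choiceType) (f : X -> Y) (b : Y) :
  injective f -> finite_set [set a | f a = b].
Proof.
move=> f_inj; have [[a0 fa0]|nf] := pselect (exists a, f a = b).
  by apply: (sub_finite_set _ (finite_set1 a0)) => a /=; rewrite -fa0 => /f_inj.
by apply: (sub_finite_set _ (finite_set0 X)) => a fa; apply: nf; exists a.
Qed.

Lemma finite_fibre_app (u : rterm) :
  finite_set [set p : rterm * rmonom | RApp p.1 p.2 = u].
Proof.
apply: (@finite_fibre1 _ _ (fun p : rterm * rmonom => RApp p.1 p.2)).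
by move=> [s ts] [s' ts'] /= /RApp_inj[-> ->].
Qed.

Lemma finite_fibre_monom (n : nat) (ts : {mset rterm}) :
  finite_set [set t : n.-tuple rterm | seq_mset t = ts].
Proof.
pose l : seq (n.-tuple rterm) := pmap insub (permutations (enum_mset ts)).
apply: sub_finite_set (finite_seq l) => t /= tE.
by rewrite mem_pmap_sub mem_permutations -tE perm_sym perm_eq_seq_mset.
Qed.

Lemma vpow_eq0 (S : vec rterm) (n : nat) (ts : {mset rterm}) :
  n <> size (enum_mset ts) -> vpow S n ts = 0.
Proof.
move=> nE; rewrite /vpow /vmonom fsbig1// => t /= tE; case: nE.
by rewrite -tE (perm_size (perm_eq_seq_mset _)) size_tuple.
Qed.

Lemma finite_vprom (S : vec rterm) (ts : rmonom) :
  finite_set [set n | nnrat_inv (n`!)%:R * vpow S n ts <> 0].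
Proof.
apply: (sub_finite_set _ (finite_set1 (size (enum_mset ts)))) => n /= n0.
by apply: contra_notP n0 => /(vpow_eq0 S) ->; rewrite mulr0.
Qed.

(* Main.v *)
Require Import Defs.
From mathcomp Require Import all_boot all_order all_algebra finmap multiset.
From mathcomp Require Import boolp classical_sets fsbigop.
Import GRing.Theory Num.Theory.
Local Open Scope ring_scope.

(** The coefficient of a monomial [ts] of size [n] in [S^!] is [1/n!] times the
    number of enumerations of [ts] times the product of the [S_t]. By the
    multinomial formula [n!] is that number times the product of the [ts(t)!],
    so that only the factors [1/ts(t)!] of [1/m(ts)] remain. *)

Lemma prod_fact_count_rem (T : eqType) (s : seq T) (x : T) : x \in s ->
  (\prod_(y <- undup s) (count_mem y s)`! =
   count_mem x s * \prod_(y <- undup (rem x s)) (count_mem y (rem x s))`!)%N.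
Proof.
move=> xs; have cE y : count_mem y (rem x s) = (count_mem y s - (x == y))%N.
  by rewrite count_rem xs.
have -> : (\prod_(y <- undup (rem x s)) (count_mem y (rem x s))`! =
           \prod_(y <- undup s) (count_mem y (rem x s))`!)%N.
  (* If [x] occurs only once in [s], it is missing from [rem x s]; its count there is then 0, and
     the extra factor is [0! = 1]. *)
  rewrite [RHS](bigID (mem (rem x s))) /= [X in (_ * X)%N]big1 ?muln1; last first.
    by move=> y /count_memPn ->.
  rewrite -[RHS]big_filter; apply: perm_big; apply: uniq_perm.
  - exact: undup_uniq.
  - exact/filter_uniq/undup_uniq.
  move=> y; rewrite mem_filter !mem_undup.
  by case: (boolP (y \in rem x s)) => //= /mem_rem ->.
(* Only the count of [x] changes, so the quotient of the two products comes from k! = k (k-1)! at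
   [x]. *)
rewrite !(bigD1_seq x) ?undup_uniq ?mem_undup//= mulnA; congr (_ * _)%N.
  have : (0 < count_mem x s)%N by rewrite -has_count has_pred1.
  by rewrite cE eqxx; case: (count_mem x s) => // k _; rewrite subn1 factS.
by apply: eq_bigr => y yx; rewrite cE eq_sym (negbTE yx) subn0.
Qed.

Lemma sum_count_undup (T : eqType) (s : seq T) :
  (\sum_(x <- undup s) count_mem x s = size s)%N.
Proof.
rewrite -sum1_size -[RHS]big_undup_iterop_count; apply: eq_bigr => x _.
by rewrite Monoid.iteropE iter_addn_0 mul1n.
Qed.

(** Induction on the size: a permutation of [s] is a head [x] among the distinct values of [s],
    followed by a permutation of [rem x s]. The head [x] accounts for count(x) (n-1)!, and the
    counts add up to n. *)
Lemma size_permutations_multinomial (T : eqType) (s : seq T) :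
  (size (permutations s) * \prod_(x <- undup s) (count_mem x s)`! =
   (size s)`!)%N.
Proof.
have [n] := ubnP (size s); elim: n s => // n IHn s.
case: (posnP (size s)) => [/size0nil -> _|s_gt0]; first by rewrite big_nil.
rewrite ltnS => sn; rewrite (perm_size (permutationsE s_gt0)).
rewrite size_allpairs_dep sumnE big_map big_distrl /=.
rewrite (eq_big_seq (fun x => count_mem x s * (size s).-1`!)%N); last first.
  move=> x; rewrite mem_undup => xs; rewrite (prod_fact_count_rem _ s x xs).
  rewrite mulnCA IHn size_rem//.
  by apply: leq_trans sn; rewrite prednK.
rewrite -big_distrl /= sum_count_undup.
by case: (size s) s_gt0 => // m _; rewrite factS.
Qed.

Lemma fsbig_fibre_inj (X Y : choiceType) (f : X -> Y) (F : X -> nnrat) (a : X) :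
  injective f -> \sum_(x \in [set x | f x = f a]%classic) F x = F a.
Proof.
move=> f_inj.
transitivity (\sum_(x \in [set a]%classic) F x); last exact: fsbig_set1.
by apply: eq_fsbigl; apply/seteqP; split=> x /= => [/f_inj|->].
Qed.

Lemma vlin_inj (X Y : choiceType) (f : X -> Y) (S : vec X) (a : X) :
  injective f -> vlin f S (f a) = S a.
Proof. exact: fsbig_fibre_inj. Qed.

Lemma vlin_neq0 (X Y : choiceType) (f : X -> Y) (S : vec X) (b : Y) :
  vlin f S b != 0 -> exists a, b = f a.
Proof.
apply: contra_neqP => nf; apply: fsbig1 => a /= fa.
by case: nf; exists a.
Qed.

Lemma RApp_uncurry_inj : injective (fun p : rterm * rmonom => RApp p.1 p.2).
Proof. by move=> [s ts] [s' ts'] /RApp_inj[/= -> ->]. Qed.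

Lemma vapp_RApp (S : vec rterm) (T : vec rmonom) (s : rterm) (ts : rmonom) :
  vapp S T (RApp s ts) = S s * T ts.
Proof.
exact: (fsbig_fibre_inj _ _ _ (fun p => S p.1 * T p.2) (s, ts) RApp_uncurry_inj).
Qed.

Lemma vapp_neq0 (S : vec rterm) (T : vec rmonom) (u : rterm) :
  vapp S T u != 0 -> exists s ts, u = RApp s ts.
Proof.
apply: contra_neqP => nf; apply: fsbig1 => -[s ts] /= fa.
by case: nf; exists s, ts.
Qed.

(** The tuples in the fibre over [ts] are the distinct enumerations of [ts], and by commutativity
    all of them contribute the same product. *)
Lemma vpow_size (S : vec rterm) (ts : rmonom) :
  vpow S (size (enum_mset ts)) ts =
  (\prod_(t <- enum_mset ts) S t) *+ size (permutations (enum_mset ts)).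
Proof.
set n := size _; pose ps := permutations (enum_mset ts).
pose l : seq (n.-tuple rterm) := pmap insub ps.
have psP t : (t \in ps) = perm_eq t (enum_mset ts) by rewrite mem_permutations.
rewrite /vpow /vmonom (_ : [set t | _]%classic = [set` l]%classic); last first.
  apply/seteqP; split=> t /=; rewrite mem_pmap_sub psP.
    by move=> <-; rewrite perm_sym perm_eq_seq_mset.
  by move=> /eq_seq_msetP ->; rewrite seq_mset_id.
rewrite -fsbig_seq; last by rewrite pmap_sub_uniq// permutations_uniq.
rewrite (eq_big_seq (fun=> \prod_(t <- enum_mset ts) S t)); last first.
  move=> t; rewrite mem_pmap_sub psP => t_ts.
  rewrite -(perm_big _ t_ts) big_tuple; apply: eq_bigr => i _.
  by congr (_ _); rewrite (tnth_nth S) /= nth_nseq ltn_ord.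
rewrite big_const_seq count_predT iter_addr_0 size_pmap_sub; congr (_ *+ _).
(* Every permutation has length [n], so [pmap insub] discards none of them. *)
apply/eqP; rewrite -all_count; apply/allP => t; rewrite psP.
by move=> /perm_size ->.
Qed.

(** The k-th power only charges monomials of size k, so a single term of the series survives. *)
Lemma vprom_size (S : vec rterm) (ts : rmonom) (n := size (enum_mset ts)) :
  vprom S ts = nnrat_inv (n`!)%:R * vpow S n ts.
Proof.
transitivity (\sum_(k \in [set n]%classic) (nnrat_inv (k`!)%:R * vpow S k ts)).
  apply/esym/fsbig_widen => // k [_ /= kn].
  by rewrite vpow_eq0 ?mulr0.
exact: (fsbig_set1 _ n).
Qed.

(** The computation moves to [rat] along the semiring morphism [val], since [nnrat] carries no field
    structure in which to divide. *)
Lemma nnval_vprom (S : vec rterm) (ts : rmonom) :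
  nnval (vprom S ts) =
  \prod_(t <- finsupp ts) (nnval (S t) ^+ ts t / (ts t)`!%:R).
Proof.
have nnval_nat k : nnval k%:R = k%:R by exact: (rmorph_nat (val : nnrat -> rat)).
rewrite vprom_size vpow_size [LHS](rmorphM (val : nnrat -> rat)) /= nnval_nat.
rewrite [X in _ * X](raddfMn (val : nnrat -> rat)).
rewrite [X in _ * (X *+ _)](rmorph_prod (val : nnrat -> rat)) /=.
rewrite big_mset /= big_split /= -[_ *+ size _]mulr_natr mulrCA; congr (_ * _).
rewrite -(size_permutations_multinomial _ (enum_mset ts)).
have -> : (\prod_(x <- undup (enum_mset ts)) (count_mem x (enum_mset ts))`! =
           \prod_(t <- finsupp ts) (ts t)`!)%N.
  rewrite (perm_big _ (perm_undup_mset ts)); apply: eq_bigr => t _.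
  by rewrite count_mem_mset.
(* The number of enumerations cancels; it is nonzero because [enum_mset ts] is one of its own
   permutations. *)
rewrite natrM invfM mulrAC mulVf ?mul1r; last first.
  rewrite pnatr_eq0 size_eq0; apply/eqP => ps0.
  by have := mem_permutations (enum_mset ts) (enum_mset ts); rewrite ps0 perm_refl.
by rewrite natr_prod prodfV.
Qed.

(** The constructors are injective with disjoint images, so a nonzero coefficient at [s] arises from
    exactly one decomposition of [s], to which the induction hypotheses apply. *)
Lemma taylorE (M : lterm) (s : rterm) :
  taylor M s != 0 -> nnval (taylor M s) = (rmult s)%:R^-1.
Proof.
have [mV mL mA ml mr] := rmultE.
elim: M s => [x|N IH|P IHP Q IHQ|P IHP Q IHQ] s /=.
- rewrite /vvar; case: (s =P RVar x) => [-> _|_]; last by rewrite eqxx.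
  by rewrite mV invr1.
- move=> nz; have [t st] := vlin_neq0 _ _ _ _ _ nz.
  by move: nz; rewrite st /vlam vlin_inj ?mL; [exact: IH | exact: RLam_inj].
- move=> nz; have [t [ts st]] := vapp_neq0 _ _ _ nz.
  move: nz; rewrite st vapp_RApp mA => nz.
  have tP : taylor P t != 0 by apply: contraNneq nz => ->; rewrite mul0r.
  have tQ : vprom (taylor Q) ts != 0.
    by apply: contraNneq nz => ->; rewrite mulr0.
  rewrite [LHS](rmorphM (val : nnrat -> rat)) /= IHP// nnval_vprom natrM invfM.
  congr (_ * _); rewrite natr_prod -prodfV; apply: eq_big_seq => u uts.
  rewrite IHQ ?natrM ?natrX ?invfM ?exprVn 1?mulrC//.
  (* The induction hypothesis at [u] needs a nonzero coefficient: otherwise the factor [0 ^+ ts u],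
     with [ts u] positive, would annihilate the coefficient of [ts]. *)
  apply: contra_neq tQ => u0; apply: val_inj => /=; rewrite nnval_vprom.
  rewrite (big_rem u)//= u0 expr0n.
  by move: uts; rewrite mem_finsupp => /negbTE ->; rewrite !mul0r.
(* No term is both an [RSuml] and an [RSumr], so at most one of the two summands is nonzero. *)
- rewrite /vadd; have [->|nzl] := eqVneq (vsuml (taylor P) s) 0.
    rewrite !add0r => nz; have [t st] := vlin_neq0 _ _ _ _ _ nz.
    by move: nz; rewrite st /vsumr vlin_inj ?mr; [exact: IHQ | exact: RSumr_inj].
  have [t st] := vlin_neq0 _ _ _ _ _ nzl.
  have -> : vsumr (taylor Q) s = 0.
    by apply/eqP/negP => /negP/vlin_neq0[u]; rewrite st.
  by rewrite !addr0 st /vsuml vlin_inj ?ml; [exact: IHP | exact: RSuml_inj].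
Qed.

Theorem theorem4p5 (M : lterm) (s : rterm) (hs : s \in taylor_supp M) :
  nnval (taylor M s) = 1 / (rmult s)%:R.
Proof. by rewrite div1r; apply: taylorE; rewrite inE in hs. Qed.
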